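(* For every non-empty set $\mathcal{D}$, $(\mathbf{H}_p^{\mathcal{D}})_+$, with the products $.$ (concatenation) and $\nwarrow$, is the free duplicial algebra generated by the elements $\bullet_d$, $d\in\mathcal{D}$.
   Context: $K$ is a commutative field. A duplicial algebra is a $K$-vector space $A$ with two bilinear products $.$ (written $xy$) and $\nwarrow$ such that for all $x,y,z\in A$: $(xy)z=x(yz)$, $(x\nwarrow y)\nwarrow z=x\nwarrow(y\nwarrow z)$, $(xy)\nwarrow z=x(y\nwarrow z)$. Being free on the elements $\bullet_d$ means: it is a duplicial algebra and for any duplicial algebra $A$ and any family $(a_d)_{d\in\mathcal{D}}$ in $A$ there is a unique morphism of duplicial algebras sending $\bullet_d$ to $a_d$ for all $d\in\mathcal{D}$. A rooted forest is a finite graph whose connected components are rooted trees, with edges oriented from leaves to roots ($w\to v$ means there is an edge from $w$ to $v$). A planar forest is a rooted forest with a total order (from left to right) on its roots and, for each vertex $v$, on $\{w:w\to v\}$. A planar forest decorated by $\mathcal{D}$ is a planar forest $F$ with a map from its vertex set to $\mathcal{D}$. $(\mathbf{H}_p^{\mathcal{D}})_+$ is the $K$-vector space with basis the non-empty planar forests decorated by $\mathcal{D}$; $\bullet_d$ is the one-vertex tree decorated by $d$. The product $FG$ is concatenation of planar forests, and $F\nwarrow G$ is the planar forest obtained by grafting $G$ on the rightmost leaf of $F$ (the roots of $G$, in order, become the children of that leaf). *)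

(* Defs.v *)
From HB Require Import structures.
From mathcomp Require Import all_boot all_algebra.
From mathcomp Require Import boolp finmap monalg.

Set Implicit Arguments.
Unset Strict Implicit.
Unset Printing Implicit Defensive.

Import GRing.Theory.
Local Open Scope ring_scope.

Section Duplicial.
Variable K : fieldType.

Record duplicial (A : lmodType K) (mul nw : A -> A -> A) : Prop := Duplicial {
  dup_mul_linearl : forall y, linear (mul^~ y);
  dup_mul_linearr : forall x, linear (mul x);
  dup_nw_linearl : forall y, linear (nw^~ y);
  dup_nw_linearr : forall x, linear (nw x);
  dup_mulA : forall x y z, mul (mul x y) z = mul x (mul y z);
  dup_nwA : forall x y z, nw (nw x y) z = nw x (nw y z);
  dup_mul_nw : forall x y z, nw (mul x y) z = mul x (nw y z)
}.

Record duplicial_morphism (A B : lmodType K) (mulA nwA : A -> A -> A)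
    (mulB nwB : B -> B -> B) (f : A -> B) : Prop := DuplicialMorphism {
  dup_morph_linear : linear f;
  dup_morph_mul : forall x y, f (mulA x y) = mulB (f x) (f y);
  dup_morph_nw : forall x y, f (nwA x y) = nwB (f x) (f y)
}.

Definition free_duplicial (D : Type) (A : lmodType K) (mul nw : A -> A -> A)
    (gen : D -> A) : Prop :=
  duplicial mul nw /\
  forall (B : lmodType K) (mulB nwB : B -> B -> B),
    duplicial mulB nwB ->
    forall b : D -> B,
      exists! f : A -> B,
        duplicial_morphism mul nw mulB nwB f /\ forall d, f (gen d) = b d.

End Duplicial.

(* Isomorphism classes of decorated planar rooted trees: a tree is the
   decoration of its root with the left-to-right list of the subtrees hanging
   from the children of the root. *)
Inductive ptree (D : Type) : Type := PNode of D & seq (ptree D).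

(* D is an arbitrary type, so equality and choice on trees are classical. *)
HB.instance Definition _ (D : Type) := gen_eqMixin (ptree D).
HB.instance Definition _ (D : Type) := gen_choiceMixin (ptree D).

Section PlanarForests.
Variable D : Type.

Definition forest := {F : seq (ptree D) | F != [::]}.

Definition single (d : D) : forest :=
  exist (fun F => F != [::]) [:: PNode d [::]] isT.

(* [graft_tree G t] makes the roots of G the children of the rightmost leaf
   of t: descend to the last child until a vertex without children is met, and
   let G be its list of children. *)
Fixpoint graft_tree (G : seq (ptree D)) (t : ptree D) : ptree D :=
  let: PNode d ts := t in
  PNode d ((fix graft_last (s : seq (ptree D)) : seq (ptree D) :=
              match s with
              | [::] => G
              | [:: u] => [:: graft_tree G u]
              | u :: s' => u :: graft_last s'
              end) ts).

(* The rightmost leaf of a non-empty forest is that of its last tree. With the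
   value G on the empty forest, [graft_treeE] holds. *)
Fixpoint graft_seq (G F : seq (ptree D)) : seq (ptree D) :=
  match F with
  | [::] => G
  | [:: t] => [:: graft_tree G t]
  | t :: F' => t :: graft_seq G F'
  end.

Lemma graft_treeE G d ts :
  graft_tree G (PNode d ts) = PNode d (graft_seq G ts).
Proof. by congr PNode; elim: ts => [|u [|v s] IH] //; congr (_ :: _). Qed.

Lemma cat_neq0 (F G : forest) : val F ++ val G != [::].
Proof. by case: F => -[]. Qed.

Lemma graft_neq0 (F G : forest) : graft_seq (val G) (val F) != [::].
Proof. by case: F => -[|t [|? ?]]. Qed.

Definition forest_cat (F G : forest) : forest :=
  exist (fun F => F != [::]) (val F ++ val G) (cat_neq0 F G).

Definition forest_graft (F G : forest) : forest :=
  exist (fun F => F != [::]) (graft_seq (val G) (val F)) (graft_neq0 F G).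

End PlanarForests.

(* The K-vector space with basis the non-empty forests; the basis vector
   attached to F is << F >>. *)
Notation Hplus K D := {malg K[forest D]}.

Section ForestAlgebra.
Variables (K : fieldType) (D : Type).

Definition bilinear_ext (op : forest D -> forest D -> forest D)
    (x y : Hplus K D) : Hplus K D :=
  \sum_(F <- msupp x) \sum_(G <- msupp y) << x@_F * y@_G *g op F G >>.

Definition Hmul : Hplus K D -> Hplus K D -> Hplus K D :=
  bilinear_ext (@forest_cat D).

Definition Hnw : Hplus K D -> Hplus K D -> Hplus K D :=
  bilinear_ext (@forest_graft D).

Definition bullet (d : D) : Hplus K D := << single d >>.

End ForestAlgebra.

(* Main.v *)
(** A non-empty planar forest is a concatenation of trees, and the tree with
    root decorated by [d] and subtrees [F] is [single d] when [F] is empty and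
    [forest_graft (single d) F] otherwise. So the one-vertex trees generate all
    non-empty forests, which gives uniqueness; the same decomposition, read as a
    recursive definition, gives the values of the required morphism on the
    basis. Compatibility with grafting follows by induction on the left operand
    from the axioms of duplicial algebras. *)

From HB Require Import structures.
Require Import Defs.
From mathcomp Require Import all_boot all_algebra monalg.
From mathcomp Require Import boolp finmap.

Set Implicit Arguments.
Unset Strict Implicit.
Unset Printing Implicit Defensive.

Import GRing.Theory.
Local Open Scope ring_scope.

Section LinearExtension.
Variables (K : fieldType) (I : choiceType).
Implicit Types (V W : lmodType K) (x y : {malg K[I]}).

(** Duplicial algebras and their morphisms carry linearity as the predicate [linear]; packing [f] as
    a [{linear V -> W}] opens the library lemmas to it. *)
Lemma linear_fun_sum V W (J : Type) (f : V -> W) (r : seq J) (v : J -> V) :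
  linear f -> f (\sum_(j <- r) v j) = \sum_(j <- r) f (v j).
Proof.
move=> lin_f.
pose g : {linear V -> W} := HB.pack f (GRing.isLinear.Build K V W *:%R f lin_f).
exact: (linear_sum g).
Qed.

Lemma linear_fun_scale V W (f : V -> W) c v : linear f -> f (c *: v) = c *: f v.
Proof.
move=> lin_f.
pose g : {linear V -> W} := HB.pack f (GRing.isLinear.Build K V W *:%R f lin_f).
exact: (linearZ_LR g).
Qed.

Lemma linear_fun_comp (U V W : lmodType K) (f : V -> W) (g : U -> V) :
  linear f -> linear g -> linear (fun u : U => f (g u)).
Proof. by move=> lin_f lin_g c u v; rewrite lin_g lin_f. Qed.

Lemma malgUZ (c : K) (i : I) : << c *g i >> = c *: << i >> :> {malg K[I]}.
Proof. by apply/malgP => j; rewrite mcoeffZ !mcoeffU mulrnAr mulr1. Qed.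

Lemma malg_linear_eq W (f g : {malg K[I]} -> W) :
  linear f -> linear g -> (forall i, f << i >> = g << i >>) -> f =1 g.
Proof.
move=> lin_f lin_g fg x; rewrite [x]monalgE !linear_fun_sum //.
by apply: eq_bigr => i _; rewrite malgUZ !linear_fun_scale // fg.
Qed.

Definition lin_ext W (f : I -> W) x : W := \sum_(i <- msupp x) x@_i *: f i.

Lemma lin_extEw W (f : I -> W) x (A : {fset I}) :
  (msupp x `<=` A)%fset -> lin_ext f x = \sum_(i <- A) x@_i *: f i.
Proof.
move=> sxA; apply: big_fset_incl => // i _ /mcoeff_outdom ->.
by rewrite scale0r.
Qed.

Lemma lin_ext_linear W (f : I -> W) : linear (lin_ext f).
Proof.
move=> c x y.
(* The three supports may differ, so all sums are taken over one set containing them. *)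
set A := (msupp (c *: x + y) `|` (msupp x `|` msupp y))%fset.
have sx : (msupp x `<=` A)%fset.
  by apply/fsubsetP => i; rewrite !in_fsetU => ->; rewrite orbT.
have sy : (msupp y `<=` A)%fset.
  by apply/fsubsetP => i; rewrite !in_fsetU => ->; rewrite !orbT.
have sxy : (msupp (c *: x + y) `<=` A)%fset by exact: fsubsetUl.
rewrite (lin_extEw f sx) (lin_extEw f sy) (lin_extEw f sxy).
rewrite scaler_sumr -big_split /=; apply: eq_bigr => i _.
by rewrite mcoeffD mcoeffZ scalerDl scalerA.
Qed.

Lemma lin_extU W (f : I -> W) i : lin_ext f << i >> = f i.
Proof. by rewrite (lin_extEw f msuppU_le) big_seq_fset1 mcoeffUU scale1r. Qed.

End LinearExtension.

Section BilinearExtension.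
Variables (K : fieldType) (D : Type).
Implicit Types (op : forest D -> forest D -> forest D) (x y z : Hplus K D).

(** As a nested linear extension, the double sum gets its linearity and its values on basis vectors
    from [lin_ext]. *)
Lemma bilinear_extE op x y :
  bilinear_ext op x y =
  lin_ext (fun F => lin_ext (fun G => << op F G >>) y) x.
Proof.
apply: eq_bigr => F _; rewrite scaler_sumr; apply: eq_bigr => G _.
by rewrite malgUZ scalerA.
Qed.

Lemma bilinear_ext_linearl op y : linear ((@bilinear_ext K D op)^~ y).
Proof. by move=> c x x'; rewrite !bilinear_extE lin_ext_linear. Qed.

Lemma bilinear_ext_linearr op x : linear (@bilinear_ext K D op x).
Proof.
move=> c y y'; rewrite !bilinear_extE /lin_ext scaler_sumr -big_split /=.
apply: eq_bigr => F _; rewrite -!/(lin_ext _ _) lin_ext_linear scalerDr.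
by rewrite !scalerA mulrC.
Qed.

Lemma bilinear_extU op F G :
  bilinear_ext op << F >> << G >> = << op F G >> :> Hplus K D.
Proof. by rewrite bilinear_extE !lin_extU. Qed.

(** Both sides are linear in each argument, so basis vectors suffice. Four separate operations let
    one statement cover all three duplicial identities. *)
Lemma bilinear_ext_assoc op1 op2 op3 op4 :
    (forall F G H, op1 (op2 F G) H = op3 F (op4 G H)) ->
  forall x y z, bilinear_ext op1 (bilinear_ext op2 x y) z =
                bilinear_ext op3 x (bilinear_ext op4 y z).
Proof.
have linl := bilinear_ext_linearl; have linr := bilinear_ext_linearr.
move=> opA x y z; move: x; apply: malg_linear_eq => [||F] //.
  exact: (linear_fun_comp (linl op1 z) (linl op2 y)).
move: y; apply: malg_linear_eq => [||G].
- exact: (linear_fun_comp (linl op1 z) (linr op2 _)).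
- exact: (linear_fun_comp (linr op3 _) (linl op4 z)).
move: z; apply: malg_linear_eq => [||H] //.
  exact: (linear_fun_comp (linr op3 _) (linr op4 _)).
by rewrite !bilinear_extU opA.
Qed.

Lemma lin_ext_morph (W : lmodType K) (f : forest D -> W) op (opW : W -> W -> W) :
    (forall w, linear (opW^~ w)) -> (forall w, linear (opW w)) ->
    (forall F G, f (op F G) = opW (f F) (f G)) ->
  forall x y, lin_ext f (bilinear_ext op x y) = opW (lin_ext f x) (lin_ext f y).
Proof.
have lin_f := lin_ext_linear f.
move=> linl linr fM x y; move: x; apply: malg_linear_eq => [||F].
- exact: (linear_fun_comp lin_f (bilinear_ext_linearl op y)).
- exact: (linear_fun_comp (linl _) lin_f).
move: y; apply: malg_linear_eq => [||G].
- exact: (linear_fun_comp lin_f (bilinear_ext_linearr op _)).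
- exact: (linear_fun_comp (linr _) lin_f).
by rewrite bilinear_extU !lin_extU.
Qed.

End BilinearExtension.

Section Forests.
Variable D : Type.
Implicit Types (F G H : forest D) (s : seq (ptree D)).

(** Induction through the nesting of [seq] in [ptree]. It targets [Type] so that it also defines
    [eval_seq]; the inner copy of [Pseq] is there for the guard condition. *)
Definition ptree_seq_rect (P : seq (ptree D) -> Type) (Pnil : P [::])
    (Pcons : forall d ts s, P ts -> P s -> P (PNode d ts :: s)) :
    forall s, P s :=
  let fix Ptree (t : ptree D) : forall s, P s -> P (t :: s) :=
    let: PNode d ts := t in fun s Ps =>
    let fix Pseq (r : seq (ptree D)) : P r :=
      if r is u :: r' then Ptree u r' (Pseq r') else Pnil in
    Pcons d ts s (Pseq ts) Ps in
  fix Pseq (r : seq (ptree D)) : P r :=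
    if r is u :: r' then Ptree u r' (Pseq r') else Pnil.

(** The rightmost leaf of a concatenation lies in its right factor once that factor is non-empty,
    hence a [forest] there. *)
Lemma graft_seq_cat r s F :
  graft_seq r (s ++ val F) = s ++ graft_seq r (val F).
Proof.
case: F => F /= F0; elim: s => [|t s IH] //=.
by rewrite -IH; case: s {IH} => //; case: F F0.
Qed.

(** After grafting [G] on [s], the rightmost leaf is that of [G]. Allowing [s] empty lets the
    induction reach the children of a leaf, where both sides are [graft_seq (val H) (val G)]. *)
Lemma graft_seqA (G : forest D) s H :
  graft_seq (val H) (graft_seq (val G) s) =
  graft_seq (graft_seq (val H) (val G)) s.
Proof.
have graft1 X t : graft_seq X [:: t] = [:: graft_tree X t] by [].
elim/ptree_seq_rect: s => // d ts [IH _|u r _ IH].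
  by rewrite !graft1 !graft_treeE IH.
have graft2 X t v r' :
  graft_seq X [:: t, v & r'] = t :: graft_seq X (v :: r') by [].
rewrite !graft2 -IH.
(* The tail stays non-empty after grafting, so the outer graft also passes over the first tree. *)
case E: (graft_seq (val G) (u :: r)) => [|v r'] //.
by have /eqP[] := graft_neq0 (exist _ (u :: r) isT) G.
Qed.

Lemma forest_catA F G H :
  forest_cat (forest_cat F G) H = forest_cat F (forest_cat G H).
Proof. by apply: val_inj; rewrite /= catA. Qed.

Lemma forest_graftA F G H :
  forest_graft (forest_graft F G) H = forest_graft F (forest_graft G H).
Proof. by apply: val_inj; rewrite /= graft_seqA. Qed.

Lemma forest_cat_graft F G H :
  forest_graft (forest_cat F G) H = forest_cat F (forest_graft G H).
Proof. by apply: val_inj; rewrite /= graft_seq_cat. Qed.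

Lemma forest_ind (P : forest D -> Prop) :
    (forall d, P (single d)) ->
    (forall d F, P F -> P (forest_graft (single d) F)) ->
    (forall F G, P F -> P G -> P (forest_cat F G)) ->
  forall F, P F.
Proof.
(* Non-emptiness stays a premise of the induction, so the hypothesis for an empty list of children
   or an empty tail is vacuous. *)
move=> Psingle Pgraft Pcat [s]; elim/ptree_seq_rect: s => // d ts s IHts IHs.
have Ptree : P (exist _ [:: PNode d ts] isT).
  case: ts IHts => [_|t ts IHts]; first exact: Psingle.
  by have := Pgraft d _ (IHts isT); congr P; apply: val_inj.
case: s IHs => [_ i|t s IHs i]; first by move: Ptree; congr P; apply: val_inj.
by have := Pcat _ _ Ptree (IHs isT); congr P; apply: val_inj.
Qed.

End Forests.

Section Evaluation.
Variables (K : fieldType) (D : Type) (B : lmodType K) (mul nw : B -> B -> B).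
Hypothesis dupB : duplicial mul nw.
Variable b : D -> B.
Implicit Types F G : forest D.

(* The value [0] on the empty sequence is never used. *)
Definition eval_seq : seq (ptree D) -> B :=
  ptree_seq_rect (P := fun=> B) 0 (fun d ts s x y =>
    let v := if ts is [::] then b d else nw (b d) x in
    if s is [::] then v else mul v y).

Definition eval F : B := eval_seq (val F).

Lemma eval_graft_single d F :
  eval (forest_graft (single d) F) = nw (b d) (eval F).
Proof. by case: F => -[]. Qed.

(** The recursion splits off the first tree, so reassociating [mul] handles a longer left factor. *)
Lemma eval_cat F G : eval (forest_cat F G) = mul (eval F) (eval G).
Proof.
have eval_cons t s : s != [::] ->
  eval_seq (t :: s) = mul (eval_seq [:: t]) (eval_seq s).
  by case: t => d ts; case: s.
case: F G => s s0 [r r0]; rewrite /eval /=.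
elim: s s0 => // t [_ _|u s IH _]; first exact: eval_cons.
by rewrite cat_cons eval_cons // IH // -(dup_mulA dupB) -eval_cons.
Qed.

(** A tree with children calls for associativity of [nw]; a concatenation calls for the mixed axiom,
    as the graft lands in its right factor. *)
Lemma eval_graft F G : eval (forest_graft F G) = nw (eval F) (eval G).
Proof.
elim/forest_ind: F => [d|d F IH|F1 F2 _ IH]; first exact: eval_graft_single.
  by rewrite forest_graftA !eval_graft_single IH (dup_nwA dupB).
by rewrite forest_cat_graft !eval_cat IH (dup_mul_nw dupB).
Qed.

Lemma lin_ext_eval_morphism :
  duplicial_morphism (@Hmul K D) (@Hnw K D) mul nw (lin_ext eval).
Proof.
case: dupB => mul_l mul_r nw_l nw_r _ _ _.
split; first exact: lin_ext_linear.
- exact: lin_ext_morph mul_l mul_r eval_cat.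
- exact: lin_ext_morph nw_l nw_r eval_graft.
Qed.

Lemma lin_ext_eval_unique (f : Hplus K D -> B) :
    duplicial_morphism (@Hmul K D) (@Hnw K D) mul nw f ->
    (forall d, f (bullet K d) = b d) ->
  f =1 lin_ext eval.
Proof.
case=> lin_f fM fN fb; apply: malg_linear_eq (lin_ext_linear _) _ => // F.
rewrite lin_extU; elim/forest_ind: F => [d|d F IH|F G IHF IHG].
- exact: fb.
(* The basis vector of a composite forest is read backwards as a product of basis vectors, which [f]
   preserves. *)
- rewrite -(bilinear_extU K (@forest_graft D)) -/(Hnw _ _) fN IH.
  by rewrite eval_graft_single -fb.
- by rewrite -(bilinear_extU K (@forest_cat D)) -/(Hmul _ _) fM IHF IHG eval_cat.
Qed.

End Evaluation.

Theorem proposition16 (K : fieldType) (D : Type) (hD : inhabited D) :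
  @free_duplicial K D (Hplus K D) (@Hmul K D) (@Hnw K D) (@bullet K D).
Proof.
split.
  split; try exact: bilinear_ext_linearl; try exact: bilinear_ext_linearr.
  - exact: bilinear_ext_assoc (@forest_catA D).
  - exact: bilinear_ext_assoc (@forest_graftA D).
  - exact: bilinear_ext_assoc (@forest_cat_graft D).
move=> B mul nw dupB b; exists (lin_ext (eval mul nw b)); split.
  split; first exact: lin_ext_eval_morphism.
  by move=> d; rewrite /bullet lin_extU.
move=> f [f_morph fb]; apply/funext => x.
by rewrite (lin_ext_eval_unique dupB f_morph fb).
Qed.
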